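(* Let $n\ge1$, let $M$ be the set of Lebesgue measurable functions $f:\mathbb{R}^n\to[0,1]$ with the supremum metric, let $K\in L^1(\mathbb{R}^n)$ be real-valued, and let $G:\mathbb{R}\to\mathbb{R}$ be bounded and Lipschitz continuous. Let $F:M\times[0,\infty)\to M$ be the unique forward flow forward tangent to the Lenia arc field $X_t(f)=[f+t\,G\circ(K*f)]_0^1$ on $M$. Fix $f_0\in M$ and put $f_t:=F_t(f_0)$. Then for every $x\in\mathbb{R}^n$ and $t\ge0$ the pointwise forward derivative $\frac{d}{dt^+}f_t(x):=\lim_{h\to0^+}\frac{f_{t+h}(x)-f_t(x)}{h}$ exists and $$\frac{d}{dt^+}f_t(x)=\begin{cases}G\big((K*f_t)(x)\big)&\text{if }0<f_t(x)<1,\\ \min\{G\big((K*f_t)(x)\big),0\}&\text{if }f_t(x)=1,\\ \max\{G\big((K*f_t)(x)\big),0\}&\text{if }f_t(x)=0.\end{cases}$$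
   Context: Functions in $M$ are actual functions (not classes modulo null sets), $d_\infty(f,g)=\sup_x|f(x)-g(x)|$. Clip: $[x]_a^b:=\min\{\max\{a,x\},b\}$, applied pointwise. Convolution: $(K*f)(x)=\int_{\mathbb{R}^n}K(x-y)f(y)\,dy$. The arc field is the map $X:M\times[0,1]\to M$, $X_t(f)(x)=[f(x)+tG((K*f)(x))]_0^1$. A forward flow on $M$ is a continuous map $F:M\times[0,\infty)\to M$ with $F_0(f)=f$ and $F_t(F_s(f))=F_{s+t}(f)$ for all $f\in M$, $s,t\ge0$. It is forward tangent to $X$ if $\lim_{h\to0^+}\frac{d_\infty(F_{t+h}(f),X_h(F_t(f)))}{h}=0$ for all $t\ge0$, $f\in M$. Under the stated hypotheses on $K$ and $G$ there exists exactly one forward flow forward tangent to $X$. *)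

(* Defs.v *)
From HB Require Import structures.
From mathcomp Require Import all_boot all_order all_algebra.
From mathcomp Require Import all_classical all_reals all_analysis.
From mathcomp Require Import lra.

Set Implicit Arguments.
Unset Strict Implicit.
Unset Printing Implicit Defensive.

Import Order.TTheory GRing.Theory Num.Theory.
Import numFieldNormedType.Exports.

Local Open Scope classical_set_scope.
Local Open Scope ring_scope.

(* Lebesgue measure on R^(n.+1): the outer measure defined by countable covers
   by half-open boxes, then Caratheodory's construction.  The measurable sets
   are thus all Lebesgue measurable sets, not only the Borel sets. *)
Section lebesgue_measure_n.
Context (R : realType) (n : nat).
Notation Rn := 'rV[R]_n.+1.

Definition box (ab : Rn * Rn) : set Rn :=
  [set x | forall i, ab.1 0 i < x 0 i <= ab.2 0 i].

(* The truncation at 0 makes the volume 0 as soon as one side is empty. *)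
Definition box_volume (ab : Rn * Rn) : R :=
  \prod_i Num.max (ab.2 0 i - ab.1 0 i) 0.

Definition box_cover (A : set Rn) : set ((Rn * Rn)^nat) :=
  [set B | A `<=` \bigcup_k box (B k)].

Definition lebesgue_outer_measure_n (A : set Rn) : \bar R :=
  ereal_inf [set (\sum_(k <oo) (box_volume (B k))%:E)%E | B in box_cover A].

Local Notation mu := lebesgue_outer_measure_n.
Local Open Scope ereal_scope.

Let vol_ge0 ab : 0 <= (box_volume ab)%:E.
Proof. by rewrite lee_fin prodr_ge0// => i _; rewrite le_max lexx orbT. Qed.

Lemma lebesgue_outer_measure_n_ge0 A : 0 <= mu A.
Proof. by apply: le_ereal_inf_tmp => x [B _ <-{x}]; exact: nneseries_ge0. Qed.

Lemma lebesgue_outer_measure_n0 : mu set0 = 0.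
Proof.
apply/eqP; rewrite eq_le lebesgue_outer_measure_n_ge0 andbT.
apply: ereal_inf_lbound; exists (fun=> (0%R, 0%R)); first exact: sub0set.
apply: eseries0 => k _ _; congr EFin.
by rewrite /box_volume big_ord_recl /= subrr maxxx mul0r.
Qed.

Lemma le_lebesgue_outer_measure_n : {homo mu : A B / A `<=` B >-> A <= B}.
Proof.
move=> A B AB; apply/ereal_inf_le_tmp => x [C BC <-{x}].
by exists C => //; exact: subset_trans AB BC.
Qed.

Lemma lebesgue_outer_measure_n_sigma_subadditive : sigma_subadditive mu.
Proof.
move=> A; have [[i ioo]|] := pselect (exists i, mu (A i) = +oo).
  rewrite (eseries_pinfty _ _ ioo) ?leey// => k _.
  by rewrite -ltNye (lt_le_trans _ (lebesgue_outer_measure_n_ge0 _)).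
rewrite -forallNE => Aoo.
suff add2e (e : {posnum R}) :
    mu (\bigcup_k A k) <= \sum_(i <oo) mu (A i) + e%:num%:E.
  by apply/lee_addgt0Pr => _/posnumP[].
rewrite (le_trans _ (epsilon_trick _ _ _))//; last first.
  by move=> k; exact: lebesgue_outer_measure_n_ge0.
pose P k (B : (Rn * Rn)^nat) := box_cover (A k) B /\
  \sum_(j <oo) (box_volume (B j))%:E <= mu (A k) + (e%:num / (2 ^ k.+1)%:R)%:E.
have [G PG] : {G : ((Rn * Rn)^nat)^nat & forall k, P k (G k)}.
  apply: (@choice _ _ P) => k; rewrite /P /lebesgue_outer_measure_n.
  set S := (X in ereal_inf X); move infS : (ereal_inf S) => iS.
  case: iS infS => [r Sr|Soo|Soo].
  - have en1 : (0 < e%:num / (2 ^ k.+1)%:R)%R by [].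
    have /(lb_ereal_inf_adherent en1) : ereal_inf S \is a fin_num by rewrite Sr.
    move=> [x [B AnB muBx] xS].
    by exists B; split => //; rewrite muBx -Sr; exact/ltW.
  - by have := Aoo k; rewrite /lebesgue_outer_measure_n Soo.
  - suff : lbound S 0 by move/le_ereal_inf_tmp; rewrite Soo.
    by move=> /= _ [B AnB <-]; exact: nneseries_ge0.
pose v ij := (box_volume (G ij.1 ij.2))%:E : \bar R.
have v_ge0 ij : 0 <= v ij by exact: vol_ge0.
apply: (@le_trans _ _ (\esum_(i in [set: nat * nat]) v i)).
  apply: ereal_inf_lbound => /=.
  have /card_esym/ppcard_eqP[f] := card_nat2.
  exists (uncurry G \o f).
    apply: (@subset_trans _ (\bigcup_i \bigcup_k box (G i k))) => [t [i _]|].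
      by move=> /(PG i).1 -[j _ ?]; exists i => //; exists j.
    move=> t [i _ [j _ Bijt]]; exists (f^-1%FUN (i, j)) => //=.
    by rewrite invK ?inE.
  transitivity (\sum_(k <oo) (v \o f) k).
    by apply: eq_eseriesr => k _; rewrite /v /= ; case: (f k).
  rewrite -(esum_pred_image v _ xpredT) ?[fun=> _]set_true//.
  by rewrite image_eq.
rewrite (_ : esum _ _ = \sum_(i <oo) \sum_(j <oo) v (i, j)); last first.
  pose J : nat -> set (nat * nat) := fun i => [set (i, j) | j in setT].
  rewrite (_ : setT = \bigcup_k J k); last first.
    by rewrite predeqE => -[a b]; split => // _; exists a => //; exists b.
  rewrite esum_bigcupT /=; last 2 first.
    - apply/trivIsetP => i j _ _ ij.
      rewrite predeqE => -[p m] /=; split => //= -[] [_] _ [<-{p} _].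
      by move=> [m' _] [] /esym/eqP; rewrite (negbTE ij).
    - by move=> *; exact: v_ge0.
  rewrite -(image_id [set: nat]) -fun_true esum_pred_image//; last first.
    by move=> k _; exact: esum_ge0.
  apply: eq_eseriesr => /= j _.
  rewrite -(esum_pred_image v (pair j) predT)//=; last first.
    by move=> ? ? _ _; exact: (@can_inj _ _ _ snd).
  by congr esum; rewrite predeqE => -[a b]; split; move=> [i _ <-]; exists i.
apply: lee_lim.
- apply: is_cvg_nneseries => k *.
  by apply: nneseries_ge0 => m *; exact: (v_ge0 (k, m)).
- by apply: is_cvg_nneseries => k *; apply: adde_ge0 => //;
    exact: lebesgue_outer_measure_n_ge0.
- by near=> k; apply: lee_sum => i _; exact: (PG i).2.
Unshelve. all: by end_near. Qed.

HB.instance Definition _ := isOuterMeasure.Build R Rn mu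
  lebesgue_outer_measure_n0 lebesgue_outer_measure_n_ge0
  le_lebesgue_outer_measure_n lebesgue_outer_measure_n_sigma_subadditive.

End lebesgue_measure_n.

Notation lebesgue_space R n :=
  (caratheodory_type (@lebesgue_outer_measure_n R n)).

Section lebesgue_measure_n_instance.
Context (R : realType) (n : nat).

Definition lebesgue_measure_n : set (lebesgue_space R n) -> \bar R :=
  @lebesgue_outer_measure_n R n.

HB.instance Definition _ := isMeasure.Build _ _ _ lebesgue_measure_n
  (caratheodory_measure0 _) (@caratheodory_measure_ge0 _ _ _)
  (@caratheodory_measure_sigma_additive _ _ _).

End lebesgue_measure_n_instance.
Arguments lebesgue_measure_n : clear implicits.

Definition sup_dist (T : Type) (R : realType) (f g : T -> R) : R :=
  sup (range (fun x => `|f x - g x|)).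

Section state_space.
Context (R : realType) (n : nat).
Notation Rn := 'rV[R]_n.+1.

Record state := State {
  state_fun :> Rn -> R ;
  state_measurable :
    measurable_fun [set: lebesgue_space R n] (state_fun : lebesgue_space R n -> R) ;
  state_range : forall x, 0 <= state_fun x <= 1
}.

HB.instance Definition _ := gen_eqMixin state.
HB.instance Definition _ := gen_choiceMixin state.

Lemma state_ext (f g : state) : f =1 g -> f = g.
Proof.
case: f g => [f mf rf] [g mg rg] /= /funext fg; subst g.
by congr State; exact: Prop_irrelevance.
Qed.

Let state_dist_ubound (f g : state) :
  has_ubound (range (fun x => `|f x - g x|)).
Proof.
exists 1 => _ [x _ <-]; have /andP[? ?] := state_range f x.
have /andP[? ?] := state_range g x.
by rewrite ler_norml; apply/andP; split; lra.
Qed.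

Let le_sup_dist (f g : state) x : `|f x - g x| <= sup_dist f g.
Proof. by apply: ub_le_sup; [exact: state_dist_ubound|exists x]. Qed.

Let sup_dist_le (f g : state) c :
  (forall x, `|f x - g x| <= c) -> sup_dist f g <= c.
Proof.
move=> fgc; apply: ge_sup => [|_ [x _ <-]]; last exact: fgc.
by exists `|f 0 - g 0|; exists 0.
Qed.

Let sup_distxx (f : state) : sup_dist f f = 0.
Proof.
apply/eqP; rewrite eq_le sup_dist_le => [|x]; last by rewrite subrr normr0.
by rewrite (le_trans _ (le_sup_dist f f 0)).
Qed.

Let sup_dist_positivity (f g : state) : sup_dist f g = 0 -> f = g.
Proof.
move=> fg0; apply: state_ext => x; apply/eqP; rewrite -subr_eq0 -normr_le0.
by rewrite -fg0 le_sup_dist.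
Qed.

Let sup_dist_sym (f g : state) : sup_dist f g = sup_dist g f.
Proof.
by rewrite /sup_dist; under eq_fun do rewrite distrC.
Qed.

Let sup_dist_triangle (g f h : state) :
  sup_dist f h <= sup_dist f g + sup_dist g h.
Proof.
apply: (@sup_dist_le f h) => x; rewrite (le_trans (ler_distD (g x) _ _))//.
by rewrite lerD// le_sup_dist.
Qed.

HB.instance Definition _ := isMetric.Build R state
  sup_distxx sup_dist_positivity sup_dist_sym sup_dist_triangle.

End state_space.
Arguments state : clear implicits.

Definition clip (R : realType) (a b x : R) : R := Num.min (Num.max a x) b.

Definition convolution (R : realType) (n : nat) (K f : 'rV[R]_n.+1 -> R)
    (x : 'rV[R]_n.+1) : R :=
  \int[lebesgue_measure_n R n]_y (K (x - y) * f y).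

Definition lenia_arc_field (R : realType) (n : nat) (K : 'rV[R]_n.+1 -> R)
    (G : R -> R) (f : 'rV[R]_n.+1 -> R) (t : R) : 'rV[R]_n.+1 -> R :=
  fun x => clip 0 1 (f x + t * G (convolution K f x)).

(* Time ranges over R; the values at negative times are irrelevant. *)
Definition forward_flow (R : realType) (M : topologicalType)
    (F : M -> R -> M) : Prop :=
  [/\ {within [set p : M * R | (0 : R) <= p.2],
         continuous (fun p : M * R => F p.1 p.2)},
      forall f : M, F f 0 = f &
      forall (f : M) (s t : R), 0 <= s -> 0 <= t -> F (F f s) t = F f (s + t)].

(* The arc field is taken on plain functions, so that no proof that its values
   are measurable is needed to state tangency; sup_dist is the distance that
   underlies the metric of [state]. *)
Definition forward_tangent (R : realType) (n : nat)
    (F : state R n -> R -> state R n)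
    (X : ('rV[R]_n.+1 -> R) -> R -> ('rV[R]_n.+1 -> R)) : Prop :=
  forall (f : state R n) (t : R), 0 <= t ->
    sup_dist (F f (t + h)) (X (F f t) h) / h @[h --> 0^'+] --> (0 : R).

Definition has_forward_derivative (R : realType) (u : R -> R) (t l : R) : Prop :=
  (u (t + h) - u t) / h @[h --> 0^'+] --> l.

(* Main.v *)
Require Import Defs.
From mathcomp Require Import all_boot all_order all_algebra.
From mathcomp Require Import all_classical all_reals all_analysis.
From mathcomp Require Import lra.

Import Order.TTheory GRing.Theory Num.Theory.
Import numFieldNormedType.Exports.
Local Open Scope classical_set_scope.
Local Open Scope ring_scope.

(** Tangency bounds the difference quotient of [s |-> F f0 s x] at [t] up to
    [o(1)] by that of the arc [h |-> clip 0 1 (a + h * v)], with [a = F f0 t x]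
    and [v = G (K * F f0 t) x].  For small [h > 0] the clipping is inactive,
    except at the endpoints [a = 0] and [a = 1] when [v] points outwards, where
    the arc is constant; so the quotient of the arc is eventually constant. *)

Lemma clip_itv (R : realType) (a b x : R) : a <= b -> a <= clip a b x <= b.
Proof. by move=> ab; rewrite /clip le_min ge_min le_max !lexx ab orbT. Qed.

(** A real [sup] dominates its set only when that set is bounded above; the common range [[a, b]]
    bounds the differences by [b - a]. Stated for plain functions, it applies to the arc without a
    proof that the arc is measurable. *)
Lemma le_sup_dist_itv (T : Type) (R : realType) (a b : R) (f g : T -> R) x :
  (forall y, a <= f y <= b) -> (forall y, a <= g y <= b) ->
  `|f x - g x| <= sup_dist f g.
Proof.
move=> fab gab; apply: ub_le_sup; last by exists x.
exists (b - a) => _ [y _ <-]; have /andP[? ?] := fab y.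
by have /andP[? ?] := gab y; rewrite ler_norml; apply/andP; split; lra.
Qed.

Lemma near0_clip_affine (R : realType) (a v : R) : 0 <= a <= 1 ->
  \forall h \near 0^'+, clip 0 1 (a + h * v) =
    a + h * (if 0 < a < 1 then v
             else if a == 1 then Num.min v 0 else Num.max v 0).
Proof.
move=> /andP[a0 a1].
have small e : 0 < e -> \forall h \near (0 : R)^'+, 0 < h /\ `|h * v| < e.
  (* The [+ 1] keeps the divisor positive when [v = 0]. *)
  move=> e0; have v1 : 0 < `|v| + 1 by rewrite ltr_wpDl.
  near=> h; have h0 : 0 < h by near: h; exact: nbhs_right_gt.
  split=> //; rewrite normrM gtr0_norm//.
  have : h < e / (`|v| + 1) by near: h; apply: nbhs_right_lt; exact: divr_gt0.
  by rewrite ltr_pdivlMr//; nra.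
rewrite /clip; case: ifPn => [/andP[a_gt0 a_lt1]|a01].
  (* The distance from [a] to the nearer endpoint: a smaller displacement stays inside the
     interval. *)
  have e0 : 0 < Num.min a (1 - a) by rewrite lt_min a_gt0 subr_gt0.
  apply: filterS (small _ e0) => h [_].
  rewrite lt_min !ltr_norml => /andP[/andP[? ?] /andP[? ?]].
  by rewrite max_r ?min_l; lra.
have [a1E|a_neq1] := eqVneq a 1.
  (* A displacement below 1 cannot reach the opposite endpoint 0, so only the clip at 1 can act, and
     the sign of [v] decides whether it does. *)
  apply: filterS (small 1 ltr01) => h [h0]; rewrite ltr_norml => /andP[? ?].
  rewrite a1E max_r; last lra.
  by case: (leP v 0) => v0; [rewrite min_l|rewrite min_r]; nra.
have a0E : a = 0.
  apply/eqP; rewrite eq_le a0 andbT leNgt.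
  by apply: contra a01 => ->; rewrite lt_neqAle a_neq1.
apply: filterS (small 1 ltr01) => h [h0]; rewrite ltr_norml => /andP[? ?].
rewrite a0E !add0r.
case: (leP v 0) => v0; first by rewrite max_l ?min_l; nra.
by rewrite max_r ?min_l; nra.
Unshelve. all: by end_near. Qed.

Theorem proposition2 (R : realType) (n : nat)
    (K : 'rV[R]_n.+1 -> R) (G : R -> R) (F : state R n -> R -> state R n)
    (K_L1 : (lebesgue_measure_n R n).-integrable [set: lebesgue_space R n]
              (fun x : lebesgue_space R n => (K x)%:E))
    (G_bounded : [bounded G y | y in [set: R]])
    (G_lipschitz : [lipschitz G y | y in [set: R]])
    (F_flow : forward_flow F)
    (F_tangent : forward_tangent F (lenia_arc_field K G))
    (f0 : state R n) (x : 'rV[R]_n.+1) (t : R) (t_ge0 : 0 <= t) :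
  has_forward_derivative (fun s => F f0 s x) t
    (let v := G (convolution K (F f0 t) x) in
     if 0 < F f0 t x < 1 then v
     else if F f0 t x == 1 then Num.min v 0
     else Num.max v 0).
Proof.
move=> /=; rewrite /has_forward_derivative.
set v := G _; set w := if _ then _ else _.
have arcE := near0_clip_affine R _ v (state_range (F f0 t) x).
apply/cvgrPdist_le => e e0.
have /cvgrPdist_le/(_ e e0) dist_le := F_tangent f0 t t_ge0.
near=> h; have h0 : 0 < h by near: h; exact: nbhs_right_gt.
have arc_h : lenia_arc_field K G (F f0 t) h x = F f0 t x + h * w.
  by near: h; exact: arcE.
have := @le_sup_dist_itv _ _ 0 1 (F f0 (t + h))
  (lenia_arc_field K G (F f0 t) h) x (state_range _)
  (fun y => clip_itv _ _ _ _ ler01).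
rewrite arc_h => le_dist.
have : `|0 - sup_dist (F f0 (t + h)) (lenia_arc_field K G (F f0 t) h) / h| <= e.
  by near: h; exact: dist_le.
rewrite sub0r normrN; apply: le_trans.
(* With the arc equal to [F f0 t x + h * w], the error of the quotient is, up to sign, the gap
   between flow and arc at [x] over [h], which tangency controls. *)
have -> : w - (F f0 (t + h) x - F f0 t x) / h
    = - ((F f0 (t + h) x - (F f0 t x + h * w)) / h).
  by rewrite opprD addrA (mulrBl _ _ (h * w)) mulrAC divff ?gt_eqF// mul1r opprB.
rewrite normrN !normrM ler_wpM2r//.
exact: le_trans le_dist (ler_norm _).
Unshelve. all: by end_near. Qed.
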